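(* (a) If $K$ is a symmetric real compact nc convex set, then the restriction map $\rho:A(K)\to A(K_1)$, $\rho(f)=f|_{K_1}$, is an isometric unital order isomorphism onto $A(K_1)$. (b) If $K$ is any real compact nc convex set, then the restriction map $\rho_2:A(K)\to A(K_2,M_2(\mathbb{R}))$, $\rho_2(f)=f|_{K_2}$, is a contractive selfadjoint unital order embedding (i.e. $f\ge0$ iff $f(k)\ge0$ for all $k\in K_2$), and $\|f\|\le2\,\|f|_{K_2}\|$ for all $f\in A(K)$.
   Context: A real compact nc convex set over a real dual operator space $E$ is a graded set $K=\bigsqcup_nK_n$, $K_n\subseteq M_n(E)$ weak$^*$ compact, closed under direct sums $\sum\alpha_ix_i\alpha_i^{\mathsf T}$ and compressions $\beta^{\mathsf T}x\beta$ by real isometries. $K$ is symmetric if $k^{\mathsf T}=k$ (i.e. $k_{ji}=k_{ij}$) for every $k=[k_{ij}]\in K_n$ and every $n$. $A(K)$ is the real operator system of continuous nc affine maps $K\to\bigsqcup_nM_n(\mathbb{R})$ (graded, preserving direct sums and compressions, weak$^*$ continuous on each level), with $f^*(k)=f(k)^{\mathsf T}$, cones $M_n(A(K))^+=\{[f_{ij}]:[f_{ij}(k)]\ge0\ \forall k\}$, unit $1$, and norm $\|f\|=\sup_k\|f(k)\|$. $A(K_1)$ is the (classical) space of continuous affine real-valued functions on the compact convex set $K_1$ with sup norm and pointwise order; $A(K_2,M_2(\mathbb{R}))$ is the space of continuous affine maps $K_2\to M_2(\mathbb{R})$ with sup norm and pointwise order. *)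

(* Defs.v *)
From HB Require Import structures.
From mathcomp Require Import all_boot all_order all_algebra.
From mathcomp Require Import all_classical all_reals all_analysis.
Set Implicit Arguments.
Unset Strict Implicit.
Unset Printing Implicit Defensive.
Import Order.TTheory GRing.Theory Num.Theory.
Import numFieldNormedType.Exports.
Local Open Scope classical_set_scope.
Local Open Scope ring_scope.

(* The real dual operator space E is the dual F^* of a real normed space F.  A point of M_n(E) = M_n(F^* ) is identified with the
   bounded linear map F -> M_n(R), v |-> [x_ij(v)], and the weak* topology
   on M_n(E) is the topology of pointwise convergence on F. *)
Definition pt (R : realType) (F : normedModType R) (n : nat) :=
  {ptws F -> 'M[R]_n}.

Definition dualpt (R : realType) (F : normedModType R) (n : nat)
    (x : F -> 'M[R]_n) : Prop :=
  (forall (a : R) (u v : F), x (a *: u + v) = a *: x u + x v) /\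
  continuous x.

Definition isometry (R : realType) (n m : nat) (b : 'M[R]_(n, m)) : Prop :=
  b^T *m b = 1%:M.

Definition compress (R : realType) (F : normedModType R) (n m : nat)
    (b : 'M[R]_(n, m)) (x : F -> 'M[R]_n) : F -> 'M[R]_m :=
  fun v => b^T *m x v *m b.

Definition dsum (R : realType) (F : normedModType R) (n k : nat)
    (ns : 'I_k -> nat) (a : forall i, 'M[R]_(n, ns i))
    (x : forall i, F -> 'M[R]_(ns i)) : F -> 'M[R]_n :=
  fun v => \sum_(i < k) (a i *m x i v *m (a i)^T).

Definition dsum_iso (R : realType) (n k : nat) (ns : 'I_k -> nat)
    (a : forall i, 'M[R]_(n, ns i)) : Prop :=
  (forall i, isometry (a i)) /\ \sum_(i < k) (a i *m (a i)^T) = 1%:M.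

Definition ncset (R : realType) (F : normedModType R) :=
  forall n : nat, set (pt F n).

Definition nc_compact_convex (R : realType) (F : normedModType R)
    (K : ncset F) : Prop :=
  [/\ (forall n (x : pt F n), K n x -> dualpt (x : F -> 'M[R]_n)),
      (forall n, compact (K n)),
      (forall n k (ns : 'I_k -> nat) (a : forall i, 'M[R]_(n, ns i))
              (x : forall i, pt F (ns i)),
          dsum_iso a -> (forall i, K (ns i) (x i)) ->
          K n (dsum a (fun i => (x i : F -> 'M[R]_(ns i)))))
    & (forall n m (b : 'M[R]_(n, m)) (x : pt F n),
          isometry b -> K n x -> K m (compress b x))].

Definition symmetric_nc (R : realType) (F : normedModType R)
    (K : ncset F) : Prop :=
  forall n (x : pt F n), K n x -> forall v, (x v)^T = x v.

Definition ncmap (R : realType) (F : normedModType R) :=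
  forall n : nat, pt F n -> 'M[R]_n.

Definition AK (R : realType) (F : normedModType R) (K : ncset F)
    (f : ncmap F) : Prop :=
  [/\ (forall n, {within K n, continuous (f n)}),
      (forall n k (ns : 'I_k -> nat) (a : forall i, 'M[R]_(n, ns i))
              (x : forall i, pt F (ns i)),
          dsum_iso a -> (forall i, K (ns i) (x i)) ->
          f n (dsum a (fun i => (x i : F -> 'M[R]_(ns i)))) =
          \sum_(i < k) (a i *m f (ns i) (x i) *m (a i)^T))
    & (forall n m (b : 'M[R]_(n, m)) (x : pt F n),
          isometry b -> K n x -> f m (compress b x) = b^T *m f n x *m b)].

Definition psd (R : realType) (n : nat) (A : 'M[R]_n) : Prop :=
  A^T = A /\ forall v : 'cV[R]_n, 0 <= (v^T *m A *m v) 0 0.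

Definition vnorm (R : realType) (n : nat) (v : 'cV[R]_n) : R :=
  Num.sqrt (\sum_(i < n) v i 0 ^+ 2).

Definition mnorm (R : realType) (n m : nat) (A : 'M[R]_(n, m)) : R :=
  sup [set vnorm (A *m v) | v in [set v : 'cV[R]_m | vnorm v <= 1]].

Definition AK_norm (R : realType) (F : normedModType R) (K : ncset F)
    (f : ncmap F) : R :=
  sup [set r | exists n (x : pt F n), K n x /\ r = mnorm (f n x)].

Definition AK_pos (R : realType) (F : normedModType R) (K : ncset F)
    (f : ncmap F) : Prop :=
  forall n (x : pt F n), K n x -> psd (f n x).

Definition AK_one (R : realType) (F : normedModType R) : ncmap F :=
  fun n _ => 1%:M.

Definition AK_adj (R : realType) (F : normedModType R) (f : ncmap F)
  : ncmap F := fun n x => (f n x)^T.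

Definition ccomb (R : realType) (F : normedModType R) (n : nat) (t : R)
    (x y : pt F n) : pt F n :=
  fun v => t *: (x v : 'M[R]_n) + (1 - t) *: (y v : 'M[R]_n).

(* continuous affine maps on the compact convex set K_n with values in a
   real vector space V (A(K_1) for V = R, n = 1; A(K_2,M_2(R)) for
   V = M_2(R), n = 2) *)
Definition Aff (R : realType) (F : normedModType R) (K : ncset F) (n : nat)
    (V : normedModType R) (g : pt F n -> V) : Prop :=
  {within K n, continuous g} /\
  (forall (x y : pt F n) (t : R), K n x -> K n y -> 0 <= t <= 1 ->
     K n (ccomb t x y) -> g (ccomb t x y) = t *: g x + (1 - t) *: g y).

Definition A1_norm (R : realType) (F : normedModType R) (K : ncset F)
    (g : pt F 1 -> R) : R :=
  sup [set `|g x| | x in K 1%N].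

Definition A2_norm (R : realType) (F : normedModType R) (K : ncset F)
    (g : pt F 2 -> 'M[R]_2) : R :=
  sup [set mnorm (g x) | x in K 2%N].

Definition rho (R : realType) (F : normedModType R) (f : ncmap F)
  : pt F 1 -> R := fun x => f 1%N x 0 0.

Definition rho2 (R : realType) (F : normedModType R) (f : ncmap F)
  : pt F 2 -> 'M[R]_2 := f 2%N.

(* Main.v *)
Require Import Defs.
From HB Require Import structures.
From mathcomp Require Import all_boot all_order all_algebra.
From mathcomp Require Import all_classical all_reals all_analysis.
From mathcomp Require Import ring lra.
Import Order.TTheory GRing.Theory Num.Theory.
Import numFieldNormedType.Exports.
Local Open Scope classical_set_scope.
Local Open Scope ring_scope.
Set Implicit Arguments.
Unset Strict Implicit.
Unset Printing Implicit Defensive.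

(* (b) For a unit vector v, the vectors v and f(x)v lie in a two-dimensional
   subspace, so compressing x to it shows |f(x)v| <= ||f|_(K_2)||; the same
   compressions, and y |-> y (+) y for y in K_1, transfer positivity.
   (a) If K is symmetric and x in K_2, the average of x and its conjugate by a
   quarter turn is y (+) y with y in K_1, so f(x) has no skew part.  Hence f(x)
   is the symmetric matrix of the quadratic form v |-> f(v^T x v), and f is
   determined and normed by f|_(K_1).  Conversely a continuous affine g on K_1
   extends linearly to the span of {1} x K_1 in R x E, and applying this
   extension to the entries (delta_ij, x_ij) defines a preimage of g. *)

(** * Euclidean norm, operator norm, and norm estimates from quadratic forms and small
    compressions *)

Lemma vnorm_ge0 (R : realType) (n : nat) (v : 'cV[R]_n) : 0 <= vnorm v.
Proof. exact: sqrtr_ge0. Qed.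

Lemma dotE (R : realType) (n : nat) (u v : 'cV[R]_n) :
  (u^T *m v) 0 0 = \sum_i u i 0 * v i 0.
Proof. by rewrite mxE; apply: eq_bigr => i _; rewrite mxE. Qed.

Lemma dotC (R : realType) (n : nat) (u v : 'cV[R]_n) :
  (u^T *m v) 0 0 = (v^T *m u) 0 0.
Proof. by rewrite !dotE; apply: eq_bigr => i _; rewrite mulrC. Qed.

Lemma vnorm_sqr (R : realType) (n : nat) (v : 'cV[R]_n) :
  vnorm v ^+ 2 = (v^T *m v) 0 0.
Proof.
rewrite sqr_sqrtr; last by apply: sumr_ge0 => i _; exact: sqr_ge0.
by rewrite dotE; apply: eq_bigr => i _; rewrite expr2.
Qed.

Lemma vnorm_delta (R : realType) (n : nat) (i : 'I_n) :
  vnorm (delta_mx i 0 : 'cV[R]_n) = 1.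
Proof.
apply: (@pexpIrn _ 2) => //; rewrite ?nnegrE ?vnorm_ge0// vnorm_sqr.
by rewrite trmx_delta mul_delta_mx mxE !eqxx expr1n.
Qed.

Lemma vnorm_eq0 (R : realType) (n : nat) (v : 'cV[R]_n) :
  vnorm v = 0 -> v = 0.
Proof.
move=> v0; apply/colP => i; rewrite mxE.
have := vnorm_sqr v; rewrite v0 expr0n dotE /= => /esym/eqP.
rewrite psumr_eq0; last by move=> j _; rewrite -expr2 sqr_ge0.
by move=> /allP/(_ i (mem_index_enum _)); rewrite -expr2 sqrf_eq0 => /eqP.
Qed.

Lemma vnormZ (R : realType) (n : nat) (a : R) (v : 'cV[R]_n) :
  vnorm (a *: v) = `|a| * vnorm v.
Proof.
rewrite /vnorm; under eq_bigr do rewrite mxE exprMn.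
by rewrite -mulr_sumr sqrtrM ?sqr_ge0// sqrtr_sqr.
Qed.

Lemma vnorm_normalize (R : realType) (n : nat) (v : 'cV[R]_n) :
  vnorm v != 0 -> vnorm ((vnorm v)^-1 *: v) = 1.
Proof. by move=> v0; rewrite vnormZ normfV ger0_norm ?vnorm_ge0// mulVf. Qed.

Lemma isometry_col (R : realType) (n : nat) (v : 'cV[R]_n) :
  vnorm v = 1 -> Defs.isometry v.
Proof.
move=> v1; apply/matrixP => i j; rewrite !ord1 -vnorm_sqr v1 expr1n.
by rewrite mxE.
Qed.

Lemma coord_le_vnorm (R : realType) (n : nat) (v : 'cV[R]_n) i :
  `|v i 0| <= vnorm v.
Proof.
rewrite -sqrtr_sqr ler_wsqrtr// (bigD1 i)//= lerDl.
by apply: sumr_ge0 => j _; exact: sqr_ge0.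
Qed.

Lemma vnorm_le_sum (R : realType) (n : nat) (v : 'cV[R]_n) :
  vnorm v <= \sum_i `|v i 0|.
Proof.
have S0 : 0 <= \sum_i `|v i 0| by exact: sumr_ge0.
rewrite -(ler_sqr _ S0) ?nnegrE ?vnorm_ge0// vnorm_sqr dotE expr2 mulr_suml.
apply: ler_sum => i _; rewrite -[leLHS]ger0_norm -?expr2 ?sqr_ge0//.
rewrite expr2 normrM.
by apply: ler_wpM2l => //; rewrite (bigD1 i)//= lerDl sumr_ge0.
Qed.

Lemma vnorm_mul_le (R : realType) (n m : nat) (A : 'M[R]_(n, m)) v :
  vnorm v <= 1 -> vnorm (A *m v) <= \sum_i \sum_j `|A i j|.
Proof.
move=> v1; apply: (le_trans (vnorm_le_sum _)); apply: ler_sum => i _.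
rewrite mxE; apply: (le_trans (ler_norm_sum _ _ _)); apply: ler_sum => j _.
rewrite normrM ler_piMr//; exact: le_trans (coord_le_vnorm _ _) v1.
Qed.

(** The entrywise l1 norm bounds the set in [mnorm], so its [sup] is a genuine least upper bound. *)
Lemma mnorm_ubound (R : realType) (n m : nat) (A : 'M[R]_(n, m)) v :
  vnorm v <= 1 -> vnorm (A *m v) <= mnorm A.
Proof.
move=> v1; apply: ub_le_sup; last by exists v.
by exists (\sum_i \sum_j `|A i j|) => _ [w w1 <-]; exact: vnorm_mul_le.
Qed.

Lemma vnorm0 (R : realType) (n : nat) : vnorm (0 : 'cV[R]_n) = 0.
Proof. by rewrite -(scale0r 0) vnormZ normr0 mul0r. Qed.

Lemma mnorm_ge0 (R : realType) (n m : nat) (A : 'M[R]_(n, m)) : 0 <= mnorm A.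
Proof.
by apply: le_trans (mnorm_ubound _ (v := 0) _); rewrite ?vnorm_ge0 ?vnorm0.
Qed.

Lemma mnorm_le_sum (R : realType) (n m : nat) (A : 'M[R]_(n, m)) :
  mnorm A <= \sum_i \sum_j `|A i j|.
Proof.
apply: ge_sup => [|_ [v v1 <-]]; last exact: vnorm_mul_le.
by exists (vnorm (A *m 0)), 0 => //=; rewrite vnorm0.
Qed.

(** Scaling reduces the unit ball to the unit sphere; [0 <= C] takes care of the zero vector. *)
Lemma mnorm_le (R : realType) (n m : nat) (A : 'M[R]_(n, m)) C :
  0 <= C -> (forall v, vnorm v = 1 -> vnorm (A *m v) <= C) -> mnorm A <= C.
Proof.
move=> C0 AC; apply: ge_sup => [|_ [v /= v1 <-]].
  by exists (vnorm (A *m 0)), 0 => //=; rewrite vnorm0.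
have [v0|v0] := eqVneq (vnorm v) 0.
  by rewrite (vnorm_eq0 v0) mulmx0 vnorm0.
have := AC _ (vnorm_normalize v0).
rewrite -scalemxAr vnormZ normfV ger0_norm ?vnorm_ge0//.
rewrite ler_pdivrMl ?lt0r ?v0 ?vnorm_ge0// => /le_trans; apply.
by rewrite ler_piMl.
Qed.

(* Orthonormalising the pair (v, A v) reduces to compressions of size 2. *)
Lemma mnorm_le_compress2 (R : realType) (n : nat) (A : 'M[R]_n) C :
  0 <= C ->
  (forall v : 'cV_n, vnorm v = 1 -> `|(v^T *m A *m v) 0 0| <= C) ->
  (forall b : 'M[R]_(n, 2), Defs.isometry b -> mnorm (b^T *m A *m b) <= C) ->
  mnorm A <= C.
Proof.
move=> C0 AC1 AC2; apply: mnorm_le => // v v1.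
have vv : (v^T *m v) = 1%:M by exact: isometry_col.
set u := A *m v; set a := (v^T *m u) 0 0.
have aE : v^T *m u = a%:M by rewrite [LHS]mx11_scalar.
pose w := u - a *: v.
have vw : v^T *m w = 0.
  by rewrite mulmxBr -scalemxAr vv aE scalemx1 subrr.
(* If [A v] is parallel to [v] there is no second direction, and the compression to the line of [v]
   suffices. *)
have [w0|w0] := eqVneq (vnorm w) 0.
  have -> : u = a *: v by apply/eqP; rewrite -subr_eq0; apply/eqP/vnorm_eq0.
  by rewrite vnormZ v1 mulr1 /a /u mulmxA AC1.
pose e := (vnorm w)^-1 *: w.
have ee : e^T *m e = 1%:M by apply/isometry_col/vnorm_normalize.
have ve : v^T *m e = 0 by rewrite -scalemxAr vw scaler0.
have ev : e^T *m v = 0 by rewrite -[LHS]trmxK trmx_mul trmxK ve trmx0.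
pose b : 'M[R]_(n, 1 + 1) := row_mx v e.
have bb : Defs.isometry b.
  rewrite /Defs.isometry /b tr_row_mx mul_col_row vv ve ev ee.
  by rewrite -scalar_mx_block.
pose d : 'cV[R]_(1 + 1) := col_mx 1%:M 0.
have bd : b *m d = v by rewrite mul_row_col mulmx1 mulmx0 addr0.
have d1 : vnorm d = 1.
  apply: (@pexpIrn _ 2) => //; rewrite ?nnegrE ?vnorm_ge0//.
  by rewrite vnorm_sqr expr1n tr_col_mx mul_row_col trmx0 mul0mx addr0 mulmx1
     trmx1 mxE.
(* [u] lies in the range of the isometry [b], so [b^T] preserves its norm, and [b d = v] turns
   [b^T u] into the compressed matrix applied to [d]. *)
have -> : vnorm u = vnorm (b^T *m A *m b *m d).
  apply: (@pexpIrn _ 2) => //; rewrite ?nnegrE ?vnorm_ge0// !vnorm_sqr.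
  rewrite -!mulmxA bd -/u.
  have -> : u = b *m col_mx a%:M (vnorm w)%:M.
    by rewrite mul_row_col !mul_mx_scalar scalerA mulfV// scale1r addrC subrK.
  by rewrite (mulmxA b^T) bb mul1mx trmx_mul -mulmxA (mulmxA b^T) bb mul1mx.
by apply: le_trans (AC2 b bb); apply: mnorm_ubound; rewrite d1.
Qed.

Lemma quad_homo (R : realType) (n : nat) (A : 'M[R]_n) (v : 'cV[R]_n) :
  vnorm v != 0 ->
  let w := (vnorm v)^-1 *: v in
  (v^T *m A *m v) 0 0 = vnorm v ^+ 2 * (w^T *m A *m w) 0 0.
Proof.
move=> v0 /=; rewrite [(_ *: v)^T]linearZ /= -!scalemxAl -scalemxAr scalerA.
rewrite [RHS]mulrC.
by rewrite [in RHS]mxE; field.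
Qed.

(* Polarisation: 4 <w, A v> = <w+v, A(w+v)> - <w-v, A(w-v)>. *)
Lemma mnorm_le_sym (R : realType) (n : nat) (A : 'M[R]_n) C :
  0 <= C -> A^T = A ->
  (forall v : 'cV_n, vnorm v = 1 -> `|(v^T *m A *m v) 0 0| <= C) ->
  mnorm A <= C.
Proof.
move=> C0 AT AC; apply: mnorm_le => // v v1.
have AC' (w : 'cV_n) : `|(w^T *m A *m w) 0 0| <= C * (w^T *m w) 0 0.
  have [w0|w0] := eqVneq (vnorm w) 0.
    by rewrite (vnorm_eq0 w0) !mulmx0 mxE normr0 mulr0.
  rewrite (quad_homo _ w0) -vnorm_sqr normrM ger0_norm ?sqr_ge0//.
  by rewrite mulrC ler_wpM2r ?sqr_ge0// AC ?vnorm_normalize.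
have [u0|u0] := eqVneq (vnorm (A *m v)) 0; first by rewrite u0.
set w := (vnorm (A *m v))^-1 *: (A *m v).
have w1 : vnorm w = 1 by exact: vnorm_normalize.
have -> : vnorm (A *m v) = (w^T *m A *m v) 0 0.
  rewrite [w^T]linearZ /= -!scalemxAl mxE -mulmxA -vnorm_sqr.
  by field.
have mD (M N : 'M[R]_1) : (M + N) 0 0 = M 0 0 + N 0 0 by rewrite mxE.
have mN (M : 'M[R]_1) : (- M) 0 0 = - M 0 0 by rewrite mxE.
(* By the parallelogram law the two bounds add up to C (|w+v|^2 + |w-v|^2) = 4 C for unit
   vectors. *)
have := AC' (w + v); have := AC' (w - v).
have sw : (v^T *m A *m w) 0 0 = (w^T *m A *m v) 0 0.
  by rewrite -!mulmxA dotC trmx_mul AT mulmxA.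
have wv : (v^T *m w) 0 0 = (w^T *m v) 0 0 by exact: dotC.
have ww : (w^T *m w) 0 0 = 1 by rewrite -vnorm_sqr w1 expr1n.
have vv : (v^T *m v) 0 0 = 1 by rewrite -vnorm_sqr v1 expr1n.
rewrite ![(_ + _)^T]linearD /= ![(- _)^T]linearN /=.
rewrite !(mulmxDl, mulmxDr, mulNmx, mulmxN).
rewrite !(mD, mN, sw, wv, ww, vv).
rewrite !ler_norml => /andP[h1 h2] /andP[h3 h4]; lra.
Qed.

(** * Two-term nc convex combinations *)

Definition ncconv (R : realType) (F : normedModType R) (n m : nat)
    (b1 b2 : 'M[R]_(n, m)) (x y : pt F n) : pt F m :=
  fun v => b1^T *m (x v : 'M[R]_n) *m b1 + b2^T *m (y v : 'M[R]_n) *m b2.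

Section DirectSum2.
Variables (R : realType) (n m : nat) (b1 b2 : 'M[R]_(n, m)).

(** The two coordinate injections of R^n into R^n (+) R^n; with them [dsum] is the block diagonal
    sum. *)
Let inj2 (i : 'I_2) : 'M[R]_(n + n, n) :=
  if i == 0 then col_mx 1%:M 0 else col_mx 0 1%:M.

Lemma inj2_iso : dsum_iso inj2.
Proof.
split=> [i|].
  rewrite /Defs.isometry /inj2; case: ifP => _;
  by rewrite tr_col_mx mul_row_col trmx0 trmx1 mul1mx mul0mx ?addr0 ?add0r.
rewrite 2!big_ord_recl big_ord0 addr0 /inj2 /=.
rewrite !tr_col_mx !mul_col_row !trmx0 !trmx1 !mulmx0 !mul0mx mulmx1.
by rewrite add_block_mx !addr0 !add0r -scalar_mx_block.
Qed.

Lemma inj2_compress (M : 'I_2 -> 'M[R]_n) :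
  (col_mx b1 b2)^T *m (\sum_i (inj2 i *m M i *m (inj2 i)^T)) *m col_mx b1 b2 =
  b1^T *m M ord0 *m b1 + b2^T *m M (lift ord0 ord0) *m b2.
Proof.
set B := col_mx b1 b2.
have b1E : (inj2 ord0)^T *m B = b1.
  by rewrite tr_col_mx mul_row_col trmx0 trmx1 mul1mx mul0mx addr0.
have b2E : (inj2 (lift ord0 ord0))^T *m B = b2.
  by rewrite tr_col_mx mul_row_col trmx0 trmx1 mul1mx mul0mx add0r.
rewrite mulmx_sumr mulmx_suml 2!big_ord_recl big_ord0 addr0.
rewrite -[in RHS]b1E -[in RHS]b2E !trmx_mul !trmxK.
by rewrite !mulmxA.
Qed.

Hypothesis b12 : b1^T *m b1 + b2^T *m b2 = 1%:M.

Lemma col_mx_isometry : Defs.isometry (col_mx b1 b2).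
Proof. by rewrite /Defs.isometry tr_col_mx mul_row_col. Qed.

Variables (F : normedModType R) (K : ncset F) (x y : pt F n).
Arguments K : clear implicits.
Hypotheses (hK : nc_compact_convex K) (Kx : K n x) (Ky : K n y).

Let X (i : 'I_2) : pt F n := if i == 0 then x else y.

Let KX i : K n (X i). Proof. by rewrite /X; case: ifP. Qed.

Let ncconvE : compress (col_mx b1 b2)
  (dsum inj2 (fun i => (X i : F -> 'M[R]_n))) = ncconv b1 b2 x y.
Proof. by apply/funext => v; exact: inj2_compress. Qed.

(** The combination is the compression of x (+) y by the isometry with blocks [b1], [b2]. Convex
    combinations, y (+) y and the quarter-turn average are all instances. *)
Lemma ncconvP : K m (ncconv b1 b2 x y).
Proof.
have [_ _ Kd Kc] := hK.
rewrite -ncconvE; apply: Kc; first exact: col_mx_isometry.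
by apply: (Kd _ _ (fun=> n)) => //; exact: inj2_iso.
Qed.

Lemma AK_ncconv (f : ncmap F) : AK K f ->
  f m (ncconv b1 b2 x y) = b1^T *m f n x *m b1 + b2^T *m f n y *m b2.
Proof.
have [_ _ Kd Kc] := hK; move=> [_ fd fc].
rewrite -ncconvE fc; first last.
- by apply: (Kd _ _ (fun=> n)) => //; exact: inj2_iso.
- exact: col_mx_isometry.
rewrite (fd _ _ (fun=> n) inj2 X inj2_iso KX).
exact: (inj2_compress (fun i => f n (X i))).
Qed.

End DirectSum2.

(** * Ordinary convexity of the levels, and passage between levels one and two *)

Section NcConvex.
Variables (R : realType) (F : normedModType R) (K : ncset F).
Arguments K : clear implicits.
Hypothesis hK : nc_compact_convex K.

Lemma sqrt_weights n t : 0 <= t <= 1 ->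
  ((Num.sqrt t)%:M : 'M[R]_n)^T *m (Num.sqrt t)%:M +
  ((Num.sqrt (1 - t))%:M)^T *m (Num.sqrt (1 - t))%:M = 1%:M.
Proof.
move=> /andP[t0 t1]; rewrite !tr_scalar_mx -!scalar_mxM -!expr2 !sqr_sqrtr//.
  by rewrite -raddfD /= addrC subrK.
by rewrite subr_ge0.
Qed.

Lemma sqrt_conj n t (A : 'M[R]_n) : 0 <= t ->
  ((Num.sqrt t)%:M)^T *m A *m (Num.sqrt t)%:M = t *: A.
Proof.
move=> t0; rewrite tr_scalar_mx mul_scalar_mx mul_mx_scalar scalerA -expr2.
by rewrite sqr_sqrtr.
Qed.

(** Scalar weights sqrt t and sqrt (1 - t) make ordinary convexity a case of nc convexity, so nc
    affine maps are affine on each level. *)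
Lemma ccombE n t (x y : pt F n) : 0 <= t <= 1 ->
  ccomb t x y = ncconv (Num.sqrt t)%:M (Num.sqrt (1 - t))%:M x y.
Proof.
move=> /andP[t0 t1]; apply/funext => v.
by rewrite /ncconv !sqrt_conj// subr_ge0.
Qed.

Lemma ccombP n t (x y : pt F n) :
  0 <= t <= 1 -> K n x -> K n y -> K n (ccomb t x y).
Proof.
by move=> t01 Kx Ky; rewrite ccombE//; exact: (ncconvP (sqrt_weights n t01)).
Qed.

Lemma AK_ccomb f n t (x y : pt F n) : AK K f ->
  0 <= t <= 1 -> K n x -> K n y ->
  f n (ccomb t x y) = t *: f n x + (1 - t) *: f n y.
Proof.
move=> Kf t01 Kx Ky; rewrite ccombE// (AK_ncconv (sqrt_weights n t01) hK)//.
by have /andP[t0 t1] := t01; rewrite !sqrt_conj// subr_ge0.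
Qed.

Lemma AK_Aff_coord f n i j : AK K f -> Aff K (fun x : pt F n => f n x i j : R).
Proof.
move=> Kf; split => [|x y t Kx Ky t01 _]; last first.
  by rewrite AK_ccomb// 3!mxE.
have [fc _ _] := Kf; apply/subspace_continuousP => x Kx.
have /subspace_continuousP/(_ x Kx) fx := fc n.
apply: (@cvg_comp _ _ _ (f n) (fun M : 'M[R]_n => M i j) _ _ _ fx).
exact: coord_continuous.
Qed.

(** This is y (+) y, which moves information from [K_1] into [K_2]. *)
Definition amp2 (y : pt F 1) : pt F 2 := fun v => (y v 0 0)%:M.

(** The weights are the two unit row vectors, each placing one copy of [M] on the diagonal. *)
Lemma amp2_key (M : 'M[R]_1) :
  (delta_mx 0 0 : 'M[R]_(1, 2))^T *m M *m delta_mx 0 0 +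
  (delta_mx 0 1 : 'M[R]_(1, 2))^T *m M *m delta_mx 0 1 = (M 0 0)%:M.
Proof.
rewrite [M]mx11_scalar !mul_mx_scalar -!scalemxAl !trmx_delta !mul_delta_mx.
apply/matrixP => i j; rewrite !mxE !eqxx mulr1n.
by case: i => -[|[|//]] ?; case: j => -[|[|//]] ?;
  rewrite /= !(mulr0, mulr1, addr0, add0r).
Qed.

Lemma amp2E y : amp2 y = ncconv (delta_mx 0 0) (delta_mx 0 1) y y.
Proof. by apply/funext => v; rewrite /ncconv amp2_key. Qed.

Lemma delta_weights : (delta_mx 0 0 : 'M[R]_(1, 2))^T *m delta_mx 0 0 +
  (delta_mx 0 1 : 'M[R]_(1, 2))^T *m delta_mx 0 1 = 1%:M.
Proof. by have := amp2_key 1%:M; rewrite !mulmx1 mxE. Qed.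

Lemma amp2P y : K 1%N y -> K 2%N (amp2 y).
Proof. by move=> Ky; rewrite amp2E; exact: (ncconvP delta_weights). Qed.

Lemma AK_amp2 f y : AK K f -> K 1%N y -> f 2%N (amp2 y) = (f 1%N y 0 0)%:M.
Proof.
by move=> Kf Ky; rewrite amp2E (AK_ncconv delta_weights hK)// amp2_key.
Qed.

Lemma compress_vecP n (x : pt F n) (v : 'cV[R]_n) :
  vnorm v = 1 -> K n x -> K 1%N (compress v x).
Proof. by have [_ _ _ Kc] := hK; move=> v1; apply: Kc; exact: isometry_col. Qed.

Lemma rho_compress_vec f n (x : pt F n) (v : 'cV[R]_n) :
  AK K f -> vnorm v = 1 -> K n x ->
  rho f (compress v x) = (v^T *m f n x *m v) 0 0.
Proof.
by move=> [_ _ fc] v1 Kx; rewrite /rho fc//; exact: isometry_col.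
Qed.

(** * Boundedness, and control of the norm by level two *)

Lemma Aff_bounded n (V : normedModType R) (g : pt F n -> V) : Aff K g ->
  exists M, forall x, K n x -> `|g x| <= M.
Proof.
move=> [gc _]; have [_ Kcomp _ _] := hK.
(* Weak* compactness bounds [g], so that the suprema defining the norms are not default values. *)
have [M [_ gM]] := compact_bounded (continuous_compact gc (Kcomp n)).
by exists (M + 1) => x Kx; apply: (gM (M + 1)); [rewrite ltrDl|exists x].
Qed.

Lemma AK_bounded f n : AK K f ->
  exists M, forall x, K n x -> mnorm (f n x) <= M.
Proof.
move=> Kf.
have /choice[B fB] : forall p : 'I_n * 'I_n,
    exists M, forall x, K n x -> `|f n x p.1 p.2| <= M.
  by move=> p; exact: (Aff_bounded (AK_Aff_coord p.1 p.2 Kf)).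
exists (\sum_i \sum_j B (i, j)) => x Kx.
apply: le_trans (mnorm_le_sum _) _; apply: ler_sum => i _.
by apply: ler_sum => j _; exact: (fB (i, j)).
Qed.

(** [0 <= C] covers the empty set, whose [sup] is 0; thus [K] may have empty levels. *)
Lemma sup_le_ge0 (S : set R) C : 0 <= C -> ubound S C -> sup S <= C.
Proof.
have [->|/set0P S0] := eqVneq S set0; first by rewrite sup0.
by move=> _; exact: ge_sup.
Qed.

Lemma sup_ge0 (S : set R) :
  (forall r, S r -> 0 <= r) -> has_ubound S -> 0 <= sup S.
Proof.
have [->|/set0P [r Sr]] := eqVneq S set0; first by rewrite sup0.
by move=> S0 Sb; apply: le_trans (S0 r Sr) _; exact: ub_le_sup.
Qed.

Lemma A2_ubound f x : AK K f -> K 2%N x ->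
  mnorm (f 2%N x) <= A2_norm K (rho2 f).
Proof.
move=> Kf Kx; apply: ub_le_sup; last by exists x.
by have [M fM] := AK_bounded 2 Kf; exists M => _ [y Ky <-]; exact: fM.
Qed.

Lemma A2_norm_ge0 f : AK K f -> 0 <= A2_norm K (rho2 f).
Proof.
move=> Kf; apply: sup_ge0 => [_ [x _ <-]|]; first exact: mnorm_ge0.
by have [M fM] := AK_bounded 2 Kf; exists M => _ [y Ky <-]; exact: fM.
Qed.

(** f(y (+) y) is the scalar matrix f(y) I, whose norm is |f(y)|. *)
Lemma norm_le_A2 f y : AK K f -> K 1%N y -> `|rho f y| <= A2_norm K (rho2 f).
Proof.
move=> Kf Ky; apply: le_trans (A2_ubound Kf (amp2P Ky)).
pose e : 'cV[R]_2 := delta_mx 0 0.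
have e1 : vnorm e = 1 by exact: vnorm_delta.
apply: le_trans (mnorm_ubound _ (v := e) _); last by rewrite e1.
by rewrite (AK_amp2 Kf Ky) mul_scalar_mx vnormZ e1 mulr1.
Qed.

(** Since [f] commutes with compressions, every compression of [f n x] to size one or two is a value
    of [f] on [K_1] or [K_2]. *)
Lemma mnorm_le_A2 f n x : AK K f -> K n x ->
  mnorm (f n x) <= A2_norm K (rho2 f).
Proof.
move=> Kf Kx; apply: mnorm_le_compress2; first exact: A2_norm_ge0.
  move=> v v1; rewrite -rho_compress_vec//.
  by apply: norm_le_A2 => //; exact: compress_vecP.
move=> b bb; have [_ _ Kc] := Kf; have [_ _ _ KK] := hK.
by rewrite -Kc//; apply: A2_ubound => //; exact: KK.
Qed.

Lemma AK_norm_has_ubound f : AK K f ->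
  has_ubound [set r | exists n (x : pt F n), K n x /\ r = mnorm (f n x)].
Proof.
move=> Kf; exists (A2_norm K (rho2 f)) => _ [n [x [Kx ->]]].
exact: mnorm_le_A2.
Qed.

Lemma mnorm_le_AK f n x : AK K f -> K n x -> mnorm (f n x) <= AK_norm K f.
Proof.
move=> Kf Kx; apply: ub_le_sup; first exact: AK_norm_has_ubound.
by exists n, x.
Qed.

Lemma AK_norm_ge0 f : AK K f -> 0 <= AK_norm K f.
Proof.
move=> Kf; apply: sup_ge0; last exact: AK_norm_has_ubound.
by move=> _ [n [x [_ ->]]]; exact: mnorm_ge0.
Qed.

Lemma A2_norm_le f : AK K f -> A2_norm K (rho2 f) <= AK_norm K f.
Proof.
move=> Kf; apply: sup_le_ge0 => [|_ [x Kx <-]]; first exact: AK_norm_ge0.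
exact: mnorm_le_AK.
Qed.

Lemma AK_norm_le f : AK K f -> AK_norm K f <= A2_norm K (rho2 f).
Proof.
move=> Kf; apply: sup_le_ge0 => [|_ [n [x [Kx ->]]]]; first exact: A2_norm_ge0.
exact: mnorm_le_A2.
Qed.

(** * Principal submatrices and positivity tested on level two *)

Lemma colsub1_conj n m (s : 'I_m -> 'I_n) (A : 'M[R]_n) :
  (colsub s 1%:M)^T *m A *m colsub s 1%:M = mxsub s s A.
Proof.
have -> : (colsub s 1%:M)^T = rowsub s 1%:M :> 'M[R]_(m, n).
  by apply/matrixP => k l; rewrite !mxE eq_sym.
rewrite mul_rowsub_mx mul1mx mulmx_colsub mulmx1.
by apply/matrixP => k l; rewrite !mxE.
Qed.

Lemma colsub1_isometry n m (s : 'I_m -> 'I_n) :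
  injective s -> Defs.isometry (colsub s 1%:M : 'M[R]_(n, m)).
Proof.
move=> s_inj; rewrite /Defs.isometry -[X in X *m _]mulmx1 colsub1_conj.
by apply/matrixP => k l; rewrite !mxE (inj_eq s_inj).
Qed.

(** Selects coordinates [i] and [j], so that entry (0, 1) of the 2 x 2 submatrix is entry (i, j). *)
Definition pair_fun n (i j : 'I_n) (k : 'I_2) := if k == 0 then i else j.

Lemma pair_fun_inj n (i j : 'I_n) : i != j -> injective (pair_fun i j).
Proof.
move=> /eqP ij; case=> -[|[|//]] ?; case=> -[|[|//]] ? //=;
  rewrite /pair_fun /= => e; try exact: val_inj; by case: ij.
Qed.

Lemma AK_mxsub f n m (s : 'I_m -> 'I_n) x : AK K f -> K n x -> injective s ->
  f m (compress (colsub s 1%:M) x) = mxsub s s (f n x).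
Proof.
by move=> [_ _ fc] Kx si; rewrite fc ?colsub1_conj//; exact: colsub1_isometry.
Qed.

(** Symmetry is read off 2 x 2 principal submatrices. The quadratic form at a unit vector is a value
    of [f] on [K_1], moved to [K_2] by [amp2]. *)
Lemma AK_pos_rho2 f : AK K f ->
  (forall x, K 2%N x -> psd (rho2 f x)) -> AK_pos K f.
Proof.
move=> Kf f2 n x Kx; have [_ _ _ Kc] := hK; split=> [|v].
  apply/matrixP => i j; rewrite mxE; have [->//|ij] := eqVneq i j.
  have si := pair_fun_inj ij.
  have [+ _] := f2 _ (Kc _ _ _ _ (@colsub1_isometry _ _ _ si) Kx).
  rewrite /rho2 AK_mxsub// => /matrixP/(_ 0 1).
  by rewrite !mxE.
have [v0|v0] := eqVneq (vnorm v) 0.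
  by rewrite (vnorm_eq0 v0) mulmx0 mxE.
rewrite (quad_homo _ v0) mulr_ge0 ?sqr_ge0//.
rewrite -rho_compress_vec ?vnorm_normalize//.
set y := compress _ _.
have Ky : K 1%N y by apply: compress_vecP => //; exact: vnorm_normalize.
have [_ /(_ (delta_mx 0 0))] := f2 _ (amp2P Ky).
rewrite /rho2 AK_amp2// mul_mx_scalar -scalemxAl trmx_delta mul_delta_mx.
by rewrite !mxE !eqxx mulr1.
Qed.

Lemma rho2_Aff f : AK K f -> Aff K (rho2 f).
Proof.
move=> Kf; split=> [|x y t Kx Ky t01 _]; last exact: AK_ccomb.
by have [fc _ _] := Kf; exact: fc.
Qed.
End NcConvex.

(** * Weak* continuity of compressions *)

Lemma cvg_mx_coord (R : realType) (T : Type) (n m : nat) (G : set_system T)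
    (FG : Filter G) (h : T -> 'M[R]_(n, m)) (M : 'M[R]_(n, m)) :
  (forall i j, h x i j @[x --> G] --> M i j) -> h x @[x --> G] --> M.
Proof.
move=> hM; apply/cvg_mx_entourageP => A entA.
apply: filter_forall => i; apply: filter_forall => j.
have /cvg_entourageP/(_ A entA) MA := hM i j.
change (G [set x | (M i j, h x i j) \in A]).
have : G [set x | A (M i j, h x i j)] by exact: MA.
by apply: filterS => x /mem_set.
Qed.

(** The topology is pointwise, and at each fixed [v] the entries of [b^T x(v) b] are finite linear
    combinations of those of x(v). *)
Lemma compress_continuous (R : realType) (F : normedModType R) (n m : nat)
  (b : 'M[R]_(n, m)) : continuous (fun x : pt F n => compress b x : pt F m).
Proof.
move=> x; apply: (proj2 (@pointwise_cvgP F 'M[R]_m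
  ((fun y : pt F n => compress b y) @ nbhs x) (compress b x) _)) => v.
apply: (@cvg_mx_coord _ _ _ _ (nbhs x) _ (fun y => compress b y v)) => k l.
have bE (y : pt F n) : compress b y v k l =
    \sum_j (\sum_i b i k * (y v : 'M[R]_n) i j) * b j l.
  rewrite mxE; apply: eq_bigr => j _; rewrite mxE; congr (_ * _).
  by apply: eq_bigr => i _; rewrite mxE.
rewrite (eq_cvg _ _ bE) bE.
apply: cvg_big => [|j _]; first exact: add_continuous.
apply: cvgMr_tmp.
apply: cvg_big => [|i _]; first exact: add_continuous.
apply: cvgMl_tmp.
apply: (@cvg_comp _ _ _ (fun y : pt F n => y v) (fun M : 'M[R]_n => M i j)).
  exact: (@proj_continuous _ (fun=> 'M[R]_n) v x).
exact: coord_continuous.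
Qed.

Lemma ord2_cases (i : 'I_2) : i = 0 \/ i = 1.
Proof. by case: i => -[|[|//]] i2; [left|right]; exact: val_inj. Qed.

(** * Symmetric nc convex sets: norm, order and injectivity from level one *)

Section Symmetric.
Variables (R : realType) (F : normedModType R) (K : ncset F).
Arguments K : clear implicits.
Hypothesis hK : nc_compact_convex K.

Let c : R := Num.sqrt (1 / 2).

Let cc : c * c = 1 / 2.
Proof. by rewrite -expr2 sqr_sqrtr. Qed.

Definition quarter_turn : 'M[R]_2 := delta_mx 1 0 - delta_mx 0 1.

(** The turn swaps the diagonal entries and sends [W 0 1] to [- W 1 0]; averaging leaves half the
    trace on the diagonal and the skew part off it. *)
Lemma turn_average (W : 'M[R]_2) :
  let V := c%:M^T *m W *m c%:M +
    (c *: quarter_turn)^T *m W *m (c *: quarter_turn) in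
  [/\ V 0 0 = 1 / 2 * (W 0 0 + W 1 1), V 0 1 = 1 / 2 * (W 0 1 - W 1 0),
      V 1 0 = 1 / 2 * (W 1 0 - W 0 1) & V 1 1 = 1 / 2 * (W 0 0 + W 1 1)].
Proof.
have l1 : lift ord0 ord0 = 1 :> 'I_2 by exact: val_inj.
have o0 : ord0 = 0 :> 'I_2 by exact: val_inj.
rewrite /= -cc /quarter_turn.
do 2! rewrite !mxE !big_ord_recl !big_ord0.
rewrite !mxE l1 ?o0 /=.
by split; ring.
Qed.

Lemma turn_average_sym (W : 'M[R]_2) : W^T = W ->
  c%:M^T *m W *m c%:M + (c *: quarter_turn)^T *m W *m (c *: quarter_turn) =
  (1 / 2 * (W 0 0 + W 1 1))%:M.
Proof.
move=> /matrixP/(_ 0 1); rewrite mxE => W01.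
have /= [V00 V01 V10 V11] := turn_average W.
apply/matrixP => i j; rewrite [RHS]mxE.
by have [->|->] := ord2_cases i; have [->|->] := ord2_cases j;
  rewrite ?V00 ?V01 ?V10 ?V11 ?W01 ?subrr ?mulr0 ?mulr1n.
Qed.

Lemma turn_weights :
  (c%:M : 'M[R]_2)^T *m c%:M + (c *: quarter_turn)^T *m (c *: quarter_turn) =
  1%:M.
Proof.
have := turn_average_sym (trmx1 _ _); rewrite !mulmx1 => ->.
by congr (_%:M); rewrite !mxE /=; field.
Qed.

Let b0 : 'M[R]_(2, 1) := c *: delta_mx 0 0.
Let b1 : 'M[R]_(2, 1) := c *: delta_mx 1 0.

Let diag_average (W : 'M[R]_2) :
  (b0^T *m W *m b0 + b1^T *m W *m b1) 0 0 = 1 / 2 * (W 0 0 + W 1 1).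
Proof.
have bE (k : 'I_2) :
    ((c *: delta_mx k 0 : 'cV[R]_2)^T *m W *m
     (c *: delta_mx k 0 : 'cV[R]_2)) 0 0 = 1 / 2 * W k k.
  rewrite [(_ *: _)^T]linearZ /= trmx_delta -!scalemxAl -scalemxAr scalerA cc.
  by rewrite -rowE -colE !mxE.
by rewrite mxE !bE mulrDr.
Qed.

Let diag_weights : b0^T *m b0 + b1^T *m b1 = 1%:M.
Proof.
have := diag_average 1%:M; rewrite !mulmx1 => b01.
by apply/matrixP => i j; rewrite !ord1 b01 !mxE /=; field.
Qed.

Hypothesis symK : symmetric_nc K.

(* Averaging a symmetric x in K_2 with its conjugate by a quarter turn gives
   y (+) y with y in K_1, whereas f would keep its skew part. *)
Lemma AK_sym2 f x : AK K f -> K 2%N x -> f 2%N x 0 1 = f 2%N x 1 0.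
Proof.
move=> Kf Kx; pose y := ncconv b0 b1 x x.
have Ky : K 1%N y by exact: (ncconvP diag_weights).
have xy : ncconv c%:M (c *: quarter_turn) x x = amp2 y.
  apply/funext => v; rewrite /ncconv turn_average_sym; last exact: symK.
  by rewrite /amp2 /y /ncconv diag_average.
(* The value at [amp2 y] has no off-diagonal entry, while nc affinity makes that entry half of
   [f 2 x 0 1 - f 2 x 1 0]. *)
have := AK_ncconv turn_weights hK Kx Kx Kf.
rewrite xy (AK_amp2 hK Kf Ky) => /matrixP/(_ 0 1).
have /= [_ -> _ _] := turn_average (f 2%N x).
by rewrite mxE /= => h; lra.
Qed.

Lemma AK_sym f n x : AK K f -> K n x -> (f n x)^T = f n x.
Proof.
move=> Kf Kx; apply/matrixP => i j; rewrite mxE.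
have [->//|ij] := eqVneq i j; have si := pair_fun_inj ij.
have [_ _ _ Kc] := hK.
have := AK_sym2 Kf (Kc _ _ _ _ (@colsub1_isometry R _ _ _ si) Kx).
by rewrite (AK_mxsub Kf Kx si) !mxE /pair_fun /= => ->.
Qed.

Lemma A1_ubound f y : AK K f -> K 1%N y -> `|rho f y| <= A1_norm K (rho f).
Proof.
move=> Kf Ky; apply: ub_le_sup; last by exists y.
by exists (A2_norm K (rho2 f)) => _ [z Kz <-]; exact: norm_le_A2.
Qed.

Lemma A1_norm_ge0 f : AK K f -> 0 <= A1_norm K (rho f).
Proof.
move=> Kf; apply: sup_ge0 => [_ [y _ <-]//|].
by exists (A2_norm K (rho2 f)) => _ [z Kz <-]; exact: norm_le_A2.
Qed.

(** A symmetric matrix is normed by its quadratic form on unit vectors, whose values are values of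
    [f] on [K_1]. *)
Lemma A1_norm_AK f : AK K f -> A1_norm K (rho f) = AK_norm K f.
Proof.
move=> Kf; apply/eqP; rewrite eq_le; apply/andP; split.
  apply: sup_le_ge0 => [|_ [y Ky <-]]; first exact: AK_norm_ge0.
  exact: le_trans (norm_le_A2 hK Kf Ky) (A2_norm_le hK Kf).
apply: sup_le_ge0 => [|_ [n [x [Kx ->]]]]; first exact: A1_norm_ge0.
apply: mnorm_le_sym; [exact: A1_norm_ge0|exact: AK_sym|move=> v v1].
rewrite -(rho_compress_vec Kf v1 Kx); apply: A1_ubound => //.
exact: compress_vecP.
Qed.

Lemma rho_Aff f : AK K f -> Aff K (rho f).
Proof. by move=> Kf; exact: AK_Aff_coord. Qed.

Lemma AK_pos_rho f : AK K f -> (forall y, K 1%N y -> 0 <= rho f y) ->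
  AK_pos K f.
Proof.
move=> Kf f0 n x Kx; split=> [|v]; first exact: AK_sym.
have [v0|v0] := eqVneq (vnorm v) 0.
  by rewrite (vnorm_eq0 v0) mulmx0 mxE.
rewrite (quad_homo _ v0) mulr_ge0 ?sqr_ge0//.
rewrite -(rho_compress_vec Kf _ Kx) ?vnorm_normalize//.
by apply: f0; apply: compress_vecP => //; exact: vnorm_normalize.
Qed.

Lemma rho_inj f g : AK K f -> AK K g ->
  (forall y, K 1%N y -> rho f y = rho g y) ->
  forall n (x : pt F n), K n x -> f n x = g n x.
Proof.
move=> Kf Kg fg n x Kx; apply/eqP; rewrite -subr_eq0; apply/eqP.
set D := _ - _.
(* [D] is symmetric and its quadratic form vanishes, as both maps agree on the compressions to
   [K_1]. *)
have D0 : mnorm D <= 0.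
  apply: mnorm_le_sym => // [|v v1].
    by rewrite linearB /= !AK_sym.
  rewrite mulmxBr mulmxBl mxE [X in _ + X]mxE.
  rewrite -(rho_compress_vec Kf v1 Kx) -(rho_compress_vec Kg v1 Kx).
  rewrite fg ?subrr ?normr0//.
  exact: compress_vecP.
apply/matrixP => i j; rewrite mxE.
have e1 : vnorm (delta_mx j 0 : 'cV[R]_n) <= 1 by rewrite vnorm_delta.
have De : D *m (delta_mx j 0 : 'cV[R]_n) = 0.
  apply: vnorm_eq0; apply/eqP; rewrite eq_le vnorm_ge0 andbT.
  exact: le_trans (mnorm_ubound D e1) D0.
by move: De; rewrite -colE => /matrixP/(_ i 0); rewrite !mxE.
Qed.

End Symmetric.

(** * Linear extension of an affine function on level one, and surjectivity of restriction *)

Section Extension.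
Variables (R : realType) (F : normedModType R) (K : ncset F).
Arguments K : clear implicits.
Hypothesis hK : nc_compact_convex K.
Variable g : pt F 1 -> R.
Hypothesis gA : Aff K g.

(* The graph of the linear extension of g to the span of {1} x K_1 in
   R x E: every element of this span is (p, p y) - (q, q z). *)
Definition linext (c : R) (phi : F -> R) (s : R) : Prop :=
  exists p q y z, [/\ 0 <= p, 0 <= q, K 1%N y & K 1%N z] /\
  [/\ c = p - q,
    forall v, phi v = p * (y v : 'M[R]_1) 0 0 - q * (z v : 'M[R]_1) 0 0
    & s = p * g y - q * g z].

(** Normalising the weights to p / (p + q) gives a point of [K_1] by convexity; when p + q = 0 any
    point serves. *)
Lemma cone_add p q y z : 0 <= p -> 0 <= q -> K 1%N y -> K 1%N z ->
  exists w, [/\ K 1%N w,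
    forall v, (p + q) * (w v : 'M[R]_1) 0 0 =
              p * (y v : 'M[R]_1) 0 0 + q * (z v : 'M[R]_1) 0 0
    & (p + q) * g w = p * g y + q * g z].
Proof.
move=> p0 q0 Ky Kz; have [pq|pq] := eqVneq (p + q) 0.
  have p00 : p = 0 by lra.
  have q00 : q = 0 by lra.
  by exists y; split => // [v|]; rewrite p00 q00; ring.
pose t := p / (p + q).
have pq0 : 0 < p + q by rewrite lt0r pq addr_ge0.
have t01 : 0 <= t <= 1.
  by rewrite divr_ge0 ?addr_ge0//= ler_pdivrMr// mul1r lerDl.
have Kw := ccombP hK t01 Ky Kz.
exists (ccomb t y z); split => // [v|].
  by rewrite !mxE /t; field.
have [_ /(_ y z t Ky Kz t01 Kw) ->] := gA.
by rewrite /GRing.scale /= /t; field.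
Qed.

Lemma linext_add c phi s c' phi' s' :
  linext c phi s -> linext c' phi' s' ->
  linext (c + c') (fun v => phi v + phi' v) (s + s').
Proof.
move=> [p [q [y [z [[p0 q0 Ky Kz] [-> phiE ->]]]]]].
move=> [p' [q' [y' [z' [[p0' q0' Ky' Kz'] [-> phiE' ->]]]]]].
have [w [Kw wE gw]] := cone_add p0 p0' Ky Ky'.
have [u [Ku uE gu]] := cone_add q0 q0' Kz Kz'.
exists (p + p'), (q + q'), w, u; split; first by rewrite !addr_ge0.
split=> [|v|]; first by ring.
  by rewrite wE uE phiE phiE'; ring.
by rewrite gw gu; ring.
Qed.

Lemma linext_scale a c phi s :
  linext c phi s -> linext (a * c) (fun v => a * phi v) (a * s).
Proof.
move=> [p [q [y [z [[p0 q0 Ky Kz] [-> phiE ->]]]]]].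
have [a0|a0] := leP 0 a.
  exists (a * p), (a * q), y, z; split; first by rewrite !mulr_ge0.
  by split=> [|v|]; rewrite ?phiE; ring.
(* A negative factor exchanges the positive and negative parts, keeping both weights nonnegative. *)
exists (- a * q), (- a * p), z, y.
split; first by rewrite !mulr_ge0// oppr_ge0 ltW.
by split=> [|v|]; rewrite ?phiE; ring.
Qed.

(** Even the zero element is represented by points of [K_1], hence the witness [y] here and in the
    sums below. *)
Lemma linext0 y : K 1%N y -> linext 0 (fun=> 0) 0.
Proof.
move=> Ky; exists 0, 0, y, y; split => //.
by split=> [|v|]; ring.
Qed.

Lemma linext_ext c c' phi phi' s :
  c = c' -> phi =1 phi' -> linext c phi s -> linext c' phi' s.
Proof. by move=> -> /funext ->. Qed.

(** Well-definedness of the extension: in the difference, the constant coordinate forces p = q, and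
    then p y = p z gives y = z unless p = 0. *)
Lemma linext_fun c phi s s' : linext c phi s -> linext c phi s' -> s = s'.
Proof.
move=> l l'; have := linext_add l (linext_scale (-1) l').
move=> [p [q [y [z [[p0 q0 Ky Kz] [cE phiE sE]]]]]].
have {cE} pq : p = q by lra.
suff : p * g y = q * g z by move: sE; lra.
rewrite -pq; have [->|p_neq0] := eqVneq p 0; first by rewrite !mul0r.
congr (_ * g _); apply/funext => v; apply/matrixP => i j; rewrite !ord1.
apply: (mulfI p_neq0); have := phiE v; rewrite -pq.
lra.
Qed.

Lemma linext_sum (I : finType) (a c : I -> R) phi s y : K 1%N y ->
  (forall i, linext (c i) (phi i) (s i)) ->
  linext (\sum_i a i * c i) (fun v => \sum_i a i * phi i v) (\sum_i a i * s i).
Proof.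
move=> Ky l; elim: (index_enum I) => [|i r IH].
  rewrite !big_nil; apply: linext_ext (linext0 Ky) => // v.
  by rewrite big_nil.
rewrite !big_cons.
apply: linext_ext (linext_add (linext_scale (a i) (l i)) IH) => //.
by move=> v; rewrite big_cons.
Qed.

(** Entrywise amplification of the extension: (C, X) stands for a matrix over R x E, and [S] for its
    image. *)
Definition mlinext n m (C : 'M[R]_(n, m)) (X : F -> 'M[R]_(n, m))
    (S : 'M[R]_(n, m)) :=
  forall i j, linext (C i j) (fun v => X v i j) (S i j).

Lemma mlinext_mull n m p (P : 'M[R]_(p, n)) (C : 'M[R]_(n, m)) X S y :
  K 1%N y -> mlinext C X S ->
  mlinext (P *m C) (fun v => P *m X v) (P *m S).
Proof.
move=> Ky l i j; rewrite !mxE.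
have := linext_sum (fun k => P i k) Ky (fun k => l k j).
by apply: linext_ext => // v; rewrite mxE.
Qed.

Lemma mlinext_tr n m (C : 'M[R]_(n, m)) X S :
  mlinext C X S -> mlinext C^T (fun v => (X v)^T) S^T.
Proof.
move=> l i j; rewrite !mxE; apply: linext_ext (l j i) => // v.
by rewrite mxE.
Qed.

Lemma mlinext_ext n m (C C' : 'M[R]_(n, m)) X X' S :
  C = C' -> X =1 X' -> mlinext C X S -> mlinext C' X' S.
Proof. by move=> -> /funext ->. Qed.

Lemma mlinext_conj n m (P : 'M[R]_(m, n)) (C : 'M[R]_n) X S y :
  K 1%N y -> mlinext C X S ->
  mlinext (P *m C *m P^T) (fun v => P *m X v *m P^T) (P *m S *m P^T).
Proof.
move=> Ky l.
have := mlinext_tr (mlinext_mull P Ky (mlinext_tr (mlinext_mull P Ky l))).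
rewrite !trmx_mul !trmxK; apply: mlinext_ext => // v.
by rewrite !trmx_mul !trmxK.
Qed.

Lemma mlinext_sum n m (I : finType) (C : I -> 'M[R]_(n, m)) X S y :
  K 1%N y -> (forall i, mlinext (C i) (X i) (S i)) ->
  mlinext (\sum_i C i) (fun v => \sum_i X i v) (\sum_i S i).
Proof.
move=> Ky l i j; rewrite !summxE.
have := linext_sum (fun=> 1) Ky (fun k => l k i j).
under eq_bigr do rewrite mul1r.
under [X in linext _ _ X]eq_bigr do rewrite mul1r.
apply: linext_ext => // v; rewrite summxE.
by apply: eq_bigr => k _; rewrite mul1r.
Qed.

Lemma mlinext_fun n m (C : 'M[R]_(n, m)) X S S' :
  mlinext C X S -> mlinext C X S' -> S = S'.
Proof.
by move=> l l'; apply/matrixP => i j; exact: linext_fun (l i j) (l' i j).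
Qed.

(* Polarisation of x_ij = x_ji along the unit vectors (e_i +- e_j)/sqrt 2. *)
Definition polar_vec n (i j : 'I_n) (e : R) : 'cV[R]_n :=
  Num.sqrt (1 / 2) *: (delta_mx i 0 + e *: delta_mx j 0).

Lemma polar_vec_quad n (i j : 'I_n) e (A : 'M[R]_n) :
  ((polar_vec i j e)^T *m A *m polar_vec i j e) 0 0 =
  1 / 2 * (A i i + e * (A i j + A j i) + e ^+ 2 * A j j).
Proof.
have dE (k l : 'I_n) :
    ((delta_mx k 0 : 'cV[R]_n)^T *m A *m (delta_mx l 0 : 'cV[R]_n)) 0 0 = A k l.
  by rewrite trmx_delta -rowE -colE !mxE.
have mD (M N : 'M[R]_1) : (M + N) 0 0 = M 0 0 + N 0 0 by rewrite mxE.
have mZ a (M : 'M[R]_1) : (a *: M) 0 0 = a * M 0 0 by rewrite mxE.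
rewrite /polar_vec [(_ *: _)^T]linearZ /= [(_ + _)^T]linearD /=.
rewrite [(_ *: _)^T]linearZ /=.
rewrite !(mulmxDl, mulmxDr, =^~ scalemxAl, =^~ scalemxAr, mD, mZ, dE).
rewrite mulrA -expr2 sqr_sqrtr//.
by ring.
Qed.

Lemma polar_vec_unit n (i j : 'I_n) e : i != j -> e ^+ 2 = 1 ->
  vnorm (polar_vec i j e) = 1.
Proof.
move=> ij e1; apply: (@pexpIrn _ 2) => //; rewrite ?nnegrE ?vnorm_ge0//.
rewrite vnorm_sqr -[X in X *m _]mulmx1 polar_vec_quad !mxE !eqxx (eq_sym j).
by rewrite (negbTE ij) e1 mulr1n mulr0n; field.
Qed.

(** An explicit form of the extension at (delta_ij, x_ij): using only values of [g] on [K_1] makes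
    continuity direct. *)
Definition sym_ext : ncmap F := fun n x => \matrix_(i, j)
  if i == j then g (compress (delta_mx i 0) x)
  else 1 / 2 * (g (compress (polar_vec i j 1) x) -
                g (compress (polar_vec i j (-1)) x)).

Hypothesis symK : symmetric_nc K.

Lemma sym_extP n (x : pt F n) : K n x -> mlinext 1%:M x (sym_ext x).
Proof.
move=> Kx i j; rewrite !mxE; have [<-|ij] := eqVneq i j.
  exists 1, 0, (compress (delta_mx i 0) x), (compress (delta_mx i 0) x).
  have Ky := compress_vecP hK (vnorm_delta R i) Kx.
  split; first by rewrite !lexx ler01.
  split=> [|v|]; [by rewrite subr0| |by ring].
  by rewrite /compress trmx_delta -rowE -colE !mxE; ring.
have Kp : K 1%N (compress (polar_vec i j 1) x).
  by apply: compress_vecP => //; rewrite polar_vec_unit ?expr1n.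
have Km : K 1%N (compress (polar_vec i j (-1)) x).
  by apply: compress_vecP => //; rewrite polar_vec_unit ?sqrrN ?expr1n.
(* Equal weights cancel in the constant coordinate, matching delta_ij = 0; the difference of
   quadratic forms gives (x_ij + x_ji) / 2, which is x_ij by symmetry. *)
exists (1 / 2), (1 / 2), (compress (polar_vec i j 1) x),
  (compress (polar_vec i j (-1)) x).
split; first by split.
split=> [|v|]; [by rewrite subrr| |by ring].
rewrite /compress !polar_vec_quad.
have /matrixP/(_ i j) := symK Kx v; rewrite mxE => ->.
by field.
Qed.

Lemma coord_K1 n (i : 'I_n) (x : pt F n) : K n x ->
  K 1%N (compress (delta_mx i 0) x).
Proof. by apply: compress_vecP => //; exact: vnorm_delta. Qed.

Lemma within_compress n (v : 'cV[R]_n) : vnorm v = 1 ->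
  {within K n, continuous (fun x : pt F n => g (compress v x))}.
Proof.
move=> v1; apply/subspace_continuousP => x Kx.
have Ky := compress_vecP hK v1 Kx.
have [/subspace_continuousP/(_ _ Ky) gc _] := gA.
apply: (@cvg_comp _ _ _ (fun x : pt F n => compress v x : pt F 1) g _ _ _ _ gc).
move=> A /= nA.
have H := @compress_continuous R F n 1 v x _ nA.
change (nbhs x [set z : pt F n | K n z -> A (compress v z : pt F 1)]).
refine (@filterS _ _ (nbhs_filter x) _ _ _ H) => z Az Kz.
by apply: Az; exact: compress_vecP.
Qed.

(** For sums and compressions, both sides are images of the same matrix over R x E under the
    extension, so uniqueness identifies them. *)
Lemma sym_ext_AK : AK K sym_ext.
Proof.
have [_ _ Kd Kc] := hK; split.
- move=> n; apply/subspace_continuousP => x Kx.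
  apply: cvg_mx_coord => i j.
  have sE (z : pt F n) : sym_ext z i j =
    if i == j then g (compress (delta_mx i 0) z)
    else 1 / 2 * (g (compress (polar_vec i j 1) z) -
                  g (compress (polar_vec i j (-1)) z)) by rewrite mxE.
  rewrite (eq_cvg _ _ sE) sE; have [ij|ij] := eqVneq i j.
    by have /subspace_continuousP := within_compress (vnorm_delta R i); exact.
  apply: cvgMl_tmp; apply: cvgB.
    have : vnorm (polar_vec i j 1) = 1.
      by rewrite polar_vec_unit ?expr1n.
    by move=> /within_compress/subspace_continuousP; exact.
  have : vnorm (polar_vec i j (-1)) = 1.
    by rewrite polar_vec_unit ?sqrrN ?expr1n.
  by move=> /within_compress/subspace_continuousP; exact.
- move=> n k ns a x [ai a1] Kx; apply/matrixP => i0 j0.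
  have Kz := Kd _ _ _ _ x (conj ai a1) Kx.
  (* The index [i0] supplies a point of [K_1]; matrices of size 0 have no entries to compare. *)
  have Ky := coord_K1 i0 Kz.
  have := mlinext_sum Ky (fun i => mlinext_conj (a i) Ky (sym_extP (Kx i))).
  under eq_bigr do rewrite mulmx1.
  by rewrite a1 => /(mlinext_fun (sym_extP Kz)) ->.
- move=> n m b x bb Kx; apply/matrixP => i0 j0.
  have Kz := Kc _ _ _ _ bb Kx.
  have Ky := coord_K1 i0 Kz.
  have := mlinext_conj b^T Ky (sym_extP Kx).
  by rewrite trmxK mulmx1 bb => /(mlinext_fun (sym_extP Kz)) ->.
Qed.

Lemma rho_sym_ext x : K 1%N x -> rho sym_ext x = g x.
Proof.
move=> Kx; rewrite /rho mxE eqxx; congr g.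
apply/funext => v; apply/matrixP => i j.
by rewrite !ord1 /compress trmx_delta -rowE -colE !mxE.
Qed.

End Extension.

Theorem theorem6p10 (R : realType) (F : normedModType R) (K : ncset F) :
  nc_compact_convex K ->
  (* (a) *)
  (symmetric_nc K ->
   [/\ (forall f, AK K f -> Aff K (rho f) /\ A1_norm K (rho f) = AK_norm K f),
       (forall x, K 1%N x -> rho (@AK_one R F) x = 1),
       (forall f, AK K f ->
          (AK_pos K f <-> forall x, K 1%N x -> 0 <= rho f x)),
       (forall f g, AK K f -> AK K g ->
          (forall x, K 1%N x -> rho f x = rho g x) ->
          forall n (x : pt F n), K n x -> f n x = g n x)
     & (forall g : pt F 1 -> R, Aff K g ->
          exists f, AK K f /\ forall x, K 1%N x -> rho f x = g x)]) /\
  (* (b) *)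
  (forall f, AK K f ->
   [/\ Aff K (rho2 f),
       A2_norm K (rho2 f) <= AK_norm K f,
       (forall x, K 2%N x -> rho2 (AK_adj f) x = (rho2 f x)^T /\
                            rho2 (@AK_one R F) x = 1%:M),
       (AK_pos K f <-> forall x, K 2%N x -> psd (rho2 f x))
     & AK_norm K f <= 2 * A2_norm K (rho2 f)]).
Proof.
move=> hK; split=> [symK|f Kf].
  split=> [f Kf|x _|f Kf|f g Kf Kg fg n x Kx|g gA].
  - by split; [exact: rho_Aff|exact: A1_norm_AK].
  - by rewrite /rho mxE.
  - split=> [f0 x Kx|]; last exact: AK_pos_rho.
    have [_ /(_ 1%:M)] := f0 _ _ Kx.
    by rewrite trmx1 mul1mx mulmx1.
  - exact: rho_inj fg n x Kx.
  - by exists (sym_ext g); split; [exact: sym_ext_AK|exact: rho_sym_ext].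
split.
- exact: rho2_Aff.
- exact: A2_norm_le.
- by [].
- by split=> [f0 x|]; [exact: f0|exact: AK_pos_rho2].
(* The bound holds with constant 1; the factor 2 follows from nonnegativity of the norm. *)
- apply: le_trans (AK_norm_le hK Kf) _.
  by rewrite ler_peMl ?ler1n// A2_norm_ge0.
Qed.
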